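(* Let $M$ be a conical refinement monoid with weak divisibility of order units, and let $M^*$ be the set of order units of $M$. If $a,b,c,d\in M^*$ satisfy $a+b=c+d$, then there are elements $z_{11},z_{12},z_{21},z_{22}\in M^*$ such that $$a=z_{11}+z_{12},\quad b=z_{21}+z_{22},\quad c=z_{11}+z_{21},\quad d=z_{12}+z_{22}.$$ In particular, $M^*\cup\{0\}$ is a simple refinement monoid.
   Context: All monoids are abelian and written additively, with neutral element $0$. A monoid $M$ is pre-ordered by the algebraic ordering: $x\le y$ if $x+z=y$ for some $z\in M$. $M$ is conical if $x+y=0$ implies $x=y=0$. $M$ is a refinement monoid if whenever $a_1+a_2=b_1+b_2$ in $M$ there are $z_{ij}\in M$ ($i,j\in\{1,2\}$) with $a_i=z_{1i}+z_{2i}$ and $b_i=z_{i1}+z_{i2}$ for $i=1,2$. An order unit of $M$ is a non-zero $u\in M$ such that for every $x\in M$ there is $n\in\mathbb{N}$ with $x\le nu$. $M^*$ is a subsemigroup of $M$ and $M^*\cup\{0\}$ is a submonoid. A monoid is simple if each of its non-zero elements is an order unit in it. An element $x\in M$ is weakly divisible if $x=2a+3b$ for some $a,b\in M$; $M$ has weak divisibility of order units if every order unit of $M$ is weakly divisible. *)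

(* Defs.v *)
From HB Require Import structures.
From mathcomp Require Import all_boot all_order all_algebra.
From mathcomp Require Import boolp.

Set Implicit Arguments.
Unset Strict Implicit.
Unset Printing Implicit Defensive.

Import GRing.Theory.
Local Open Scope ring_scope.

Definition alg_le (M : nmodType) (x y : M) : Prop := exists z : M, x + z = y.

Definition conical (M : nmodType) : Prop :=
  forall x y : M, x + y = 0 -> x = 0 /\ y = 0.

Definition refinement_monoid (M : nmodType) : Prop :=
  forall a1 a2 b1 b2 : M, a1 + a2 = b1 + b2 ->
  exists z11 z12 z21 z22 : M,
    [/\ a1 = z11 + z21, a2 = z12 + z22, b1 = z11 + z12 & b2 = z21 + z22].

Definition order_unit (M : nmodType) (u : M) : Prop :=
  u <> 0 /\ forall x : M, exists n : nat, alg_le x (u *+ n).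

Definition simple_monoid (M : nmodType) : Prop :=
  forall x : M, x <> 0 -> order_unit x.

Definition weakly_divisible (M : nmodType) (x : M) : Prop :=
  exists a b : M, x = a *+ 2 + b *+ 3.

Definition weak_divisibility_of_order_units (M : nmodType) : Prop :=
  forall u : M, order_unit u -> weakly_divisible u.

Definition ounit0 (M : nmodType) : {pred M} :=
  fun x => `[< order_unit x \/ x = 0 >].

(* No conicality is needed here: if the sum of two order units is 0, it is
   still in the set, and otherwise it is an order unit. *)
Lemma ounit0_addr_closed (M : nmodType) : addr_closed (@ounit0 M).
Proof.
split; first by apply/asboolP; right.
move=> x y /asboolP[[_ xU]|->]; last by rewrite add0r.
move=> /asboolP[_|->]; last first.
  rewrite addr0; apply/asboolP.
  by have [->|/eqP x0] := eqVneq x 0; [right|left].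
apply/asboolP; have [->|/eqP xy0] := eqVneq (x + y) 0; first by right.
left; split=> // z; have [n [t zt]] := xU z.
by exists n, (t + y *+ n); rewrite addrA zt mulrnDl.
Qed.

(* The submonoid of order units and 0, as a monoid in its own right; its
   algebraic ordering and order units are computed inside it, not in M. *)
Record ounit0_monoid (M : nmodType) := OUnit0 {
  ounit0_val :> M;
  _ : @ounit0 M ounit0_val
}.

HB.instance Definition _ (M : nmodType) := [isSub for @ounit0_val M].
HB.instance Definition _ (M : nmodType) := [Choice of ounit0_monoid M by <:].
HB.instance Definition _ (M : nmodType) :=
  GRing.SubChoice_isSubNmodule.Build M (@ounit0 M) (ounit0_monoid M)
    (@ounit0_addr_closed M).

(* Main.v *)
(** Any refinement of [a + b = c + d] can be corrected one entry at a time.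
    If [x] is the entry to be enlarged, [y] and [z] its neighbours in its row and
    column and [w] the opposite entry, then for [y = f + y'] and [z = f + z'] one
    may pass to [x + f], [y'], [z'], [w + f].  The sums [x + y] and [x + z] are
    order units; in a refinement monoid two order units have a common order unit
    below them, so weak divisibility gives an order unit [e] with [2 e <= x + y]
    and [2 e <= x + z].  By refinement [e = f + g] where [2 f <= y], [2 f <= z]
    and [g <= 2 x].  Hence [x + f] is an order unit, and [y'], [z'] can be chosen
    with [y <= 2 y'] and [z <= 2 z'], so no order unit among the other entries is
    lost. *)
Require Import Defs.
From HB Require Import structures.
From mathcomp Require Import all_boot all_order all_algebra.
From mathcomp Require Import boolp.

Set Implicit Arguments.
Unset Strict Implicit.
Unset Printing Implicit Defensive.

Import GRing.Theory.
Local Open Scope ring_scope.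

Section AlgebraicOrder.
Variable M : nmodType.
Implicit Types x y z u v : M.

Lemma alg_le_refl x : alg_le x x.
Proof. by exists 0; rewrite addr0. Qed.

Lemma alg_le_trans y x z : alg_le x y -> alg_le y z -> alg_le x z.
Proof. by move=> [s <-] [t <-]; exists (s + t); rewrite addrA. Qed.

Lemma alg_le_addr x y : alg_le x (x + y).
Proof. by exists y. Qed.

Lemma alg_leD x y u v : alg_le x y -> alg_le u v -> alg_le (x + u) (y + v).
Proof. by move=> [s <-] [t <-]; exists (s + t); rewrite addrACA. Qed.

Lemma alg_le_mulrn n x y : alg_le x y -> alg_le (x *+ n) (y *+ n).
Proof. by move=> [s <-]; exists (s *+ n); rewrite mulrnDl. Qed.

Hypothesis hcon : conical M.

Lemma order_unit_of_le u v n : order_unit u -> alg_le u (v *+ n) -> order_unit v.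
Proof.
move=> [u0 uU] uv; split=> [v0|x].
  by case: uv => s; rewrite v0 mul0rn => /hcon[].
have [m xm] := uU x; exists (n * m)%N; rewrite mulrnA.
exact: alg_le_trans xm (alg_le_mulrn m uv).
Qed.

Lemma order_unitDr u x : order_unit u -> order_unit (u + x).
Proof.
move=> uU; apply: (@order_unit_of_le u _ 1) => //.
exact: alg_le_addr.
Qed.

End AlgebraicOrder.

Section Refinement.
Variable M : nmodType.
Hypotheses (hcon : conical M) (href : refinement_monoid M).
Implicit Types a b c d e f u v w x y z : M.

Lemma riesz_decomposition v x y : alg_le v (x + y) ->
  exists v1 v2, [/\ v = v1 + v2, alg_le v1 x & alg_le v2 y].
Proof.
move=> [t /href[p [q [r [s [-> _ -> ->]]]]]].
by exists p, r; split=> //; apply: alg_le_addr.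
Qed.

(** Refining the two decompositions of [a] makes [u] and [v] overlap in [p]; counting [p] once gives
    a union of [u] and [v] inside [a]. *)
Lemma alg_le_join a u v : alg_le u a -> alg_le v a ->
  exists w, [/\ alg_le w a, alg_le u w, alg_le v w & alg_le w (u + v)].
Proof.
move=> [r ra] [s sa].
have [p [q [p' [q' [eu er ev _]]]]] := href (etrans ra (esym sa)).
exists (p + p' + q); split.
- by exists q'; rewrite -ra eu er -!addrA.
- by rewrite eu; apply: alg_le_addr.
- by exists p'; rewrite ev addrAC.
- by exists p; rewrite eu ev -!addrA (addrC p q).
Qed.

(** Riesz decomposition cuts [v] into [n] pieces below [a]. Joining them stays below [a], dominates
    each piece, and does not exceed their sum [v]. *)
Lemma alg_le_common_part n v a : alg_le v (a *+ n) ->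
  exists w, [/\ alg_le w a, alg_le w v & alg_le v (w *+ n)].
Proof.
elim: n v => [|n IHn] v.
  rewrite mulr0n => -[t /hcon[-> _]]; exists 0.
  by rewrite mul0rn; split; [exists a; rewrite add0r|apply: alg_le_refl..].
rewrite mulrS => /riesz_decomposition[v1 [v2 [-> v1a /IHn[w2 [w2a w2v v2w]]]]].
have [w [wa v1w w2w wv]] := alg_le_join v1a w2a; exists w; split=> //.
  exact: alg_le_trans wv (alg_leD (alg_le_refl v1) w2v).
rewrite mulrS; apply: alg_leD => //.
exact: alg_le_trans v2w (alg_le_mulrn n w2w).
Qed.

Lemma double_le_split e x y : alg_le (e *+ 2) (x + y) ->
  exists p q, [/\ e = p + q, alg_le (p *+ 2) x & alg_le q y].
Proof.
move=> /riesz_decomposition[x1 [y1 [e2 x1x y1y]]].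
move: e2; rewrite mulr2n => /href[u [v [u' [v' [eu ev ex ey]]]]].
(* The two copies of [e] may be divided differently between [x] and [y]. Comparing the divisions,
   [p] is the part that both assign to [x], so it fits there twice; every other piece of [e] is
   assigned to [y] by at least one copy. *)
have [p [r [q [s [eqp eqq eqr eqs]]]]] := href (etrans (esym eu) ev).
exists p, (r + q + s); split.
- by rewrite eu eqp eqq -!addrA; congr (_ + _); rewrite addrCA.
- apply: alg_le_trans x1x; rewrite ex eqp eqr mulr2n addrACA.
  by apply: alg_le_addr.
- apply: alg_le_trans y1y; rewrite ey eqq eqs; exists s.
  by rewrite -!addrA (addrCA s q).
Qed.

Hypothesis hwd : weak_divisibility_of_order_units M.

Lemma order_unit_double_below a b : order_unit a -> order_unit b ->
  exists e, [/\ order_unit e, alg_le (e *+ 2) a & alg_le (e *+ 2) b].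
Proof.
move=> aU bU; have [n bn] := aU.2 b.
have [w [wa wb bw]] := alg_le_common_part bn.
have wU : order_unit w by apply: order_unit_of_le bw.
(* From [w = 2g + 3h] follows [2(g + h) <= w <= 3(g + h)], so [g + h] is again an order unit. *)
have [g [h ew]] := hwd wU.
have gw : alg_le ((g + h) *+ 2) w.
  by exists h; rewrite ew mulrnDl (mulrSr h 2) -addrA.
exists (g + h); split; [|exact: alg_le_trans gw _..].
apply: (@order_unit_of_le _ hcon w _ 3) => //.
by exists g; rewrite ew mulrnDl (mulrSr g 2) addrAC.
Qed.

Lemma order_unit_corner x y z :
  order_unit (x + y) -> order_unit (x + z) ->
  exists f y' z',
    [/\ order_unit (x + f), y = f + y', z = f + z',
        alg_le y (y' *+ 2) & alg_le z (z' *+ 2)].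
Proof.
move=> /order_unit_double_below/[apply] -[e [eU]].
rewrite ![x + _]addrC => /double_le_split[p [q [ep py qx]]].
move=> /double_le_split[p' [q' [ep' pz qx']]].
(* [f] is the common part of [p] and [p']. The rest of [e] is [s + q] with [s <= q' <= x] and
   [q <= x], whence [e <= 2(x + f)]. *)
have [f [r [s [t [eqp eqq eqp' eqq']]]]] := href (etrans (esym ep) ep').
have double_below y0 p0 : alg_le (p0 *+ 2) y0 -> alg_le f p0 ->
    exists2 y', y0 = f + y' & alg_le y0 (y' *+ 2).
  move=> p0y /(alg_le_mulrn 2) fp.
  (* Of the two copies of [f] in [y0 = 2f + t0], one is removed and one kept, so that
     [2(f + t0) = y0 + t0]. *)
  have [t0 <-] := alg_le_trans fp p0y.
  exists (f + t0); first by rewrite addrA.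
  by exists t0; rewrite mulrnDl -addrA -mulr2n.
have [|y' ey yy'] := double_below y p py; first by rewrite eqp; apply: alg_le_addr.
have [|z' ez zz'] := double_below z p' pz.
  by rewrite eqp'; apply: alg_le_addr.
exists f, y', z'; split=> //.
apply: (@order_unit_of_le _ hcon e _ 2) => //.
have sq' : alg_le s q' by rewrite eqq'; apply: alg_le_addr.
rewrite ep eqp mulr2n (addrC f s); apply: alg_leD.
  exact: alg_leD (alg_le_trans sq' qx') (alg_le_refl f).
exact: alg_le_trans qx (alg_le_addr x f).
Qed.

Lemma refinement_enlarge a b c d x y z w :
  order_unit a -> order_unit c ->
  [/\ a = x + y, b = z + w, c = x + z & d = y + w] ->
  exists x' y' z' w',
    [/\ [/\ a = x' + y', b = z' + w', c = x' + z' & d = y' + w'],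
        order_unit x', order_unit y -> order_unit y',
        order_unit z -> order_unit z' & order_unit w -> order_unit w'].
Proof.
move=> aU cU [ea eb ec ed]; rewrite ea in aU; rewrite ec in cU.
have [f [y' [z' [xfU ey ez yy' zz']]]] := order_unit_corner aU cU.
exists (x + f), y', z', (w + f); split=> //.
- split; first by rewrite ea ey addrA.
  + by rewrite eb ez -addrA addrC -addrA.
  + by rewrite ec ez addrA.
  + by rewrite ed ey -addrA addrC -addrA.
- by move=> yU; apply: order_unit_of_le yy'.
- by move=> zU; apply: order_unit_of_le zz'.
- exact: order_unitDr.
Qed.

Lemma order_unit_refinement a b c d :
  order_unit a -> order_unit b -> order_unit c -> order_unit d ->
  a + b = c + d ->
  exists z11 z12 z21 z22 : M,
    [/\ order_unit z11, order_unit z12, order_unit z21 & order_unit z22] /\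
    [/\ a = z11 + z12, b = z21 + z22, c = z11 + z21 & d = z12 + z22].
Proof.
(* The middle entries are named in swapped order because [refinement_monoid] indexes the matrix
   transposed to the goal. Permuting rows and columns then brings [x], [y], [z], [w] in turn to the
   corner being enlarged. *)
move=> aU bU cU dU /href[x0 [z0 [y0 [w0 [ea0 eb0 ec0 ed0]]]]].
have [x1 [y1 [z1 [w1 [[ea1 eb1 ec1 ed1] xU1 _ _ _]]]]] :=
  refinement_enlarge aU cU (And4 ea0 eb0 ec0 ed0).
have [y2 [x2 [w2 [z2 [[ea2 eb2 ed2 ec2] yU2 /(_ xU1) xU2 _ _]]]]] :=
  refinement_enlarge aU dU (And4 (etrans ea1 (addrC _ _))
    (etrans eb1 (addrC _ _)) ed1 ec1).
have [z3 [w3 [x3 [y3 [[eb3 ea3 ec3 ed3] zU3 _ /(_ xU2) xU3 /(_ yU2) yU3]]]]] :=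
  refinement_enlarge bU cU (And4 (etrans eb2 (addrC _ _))
    (etrans ea2 (addrC _ _)) (etrans ec2 (addrC _ _)) (etrans ed2 (addrC _ _))).
have [w [z [y [x [[eb ea ed ec] wU /(_ zU3) zU /(_ yU3) yU /(_ xU3) xU]]]]] :=
  refinement_enlarge bU dU (And4 (etrans eb3 (addrC _ _))
    (etrans ea3 (addrC _ _)) ed3 ec3).
exists x, y, z, w; split=> //.
by split; rewrite // addrC.
Qed.

End Refinement.

Lemma simple_ounit0 (M : nmodType) : conical M -> simple_monoid (ounit0_monoid M).
Proof.
move=> hcon x x0; split=> // y.
have xU : order_unit (val x).
  by have /asboolP[//|vx0] := valP x; case: x0; apply: val_inj.
have [n [t yt]] := xU.2 (val y).
(* The complement [t] of [y] in [n x] need not be an order unit, but [t + x] is. *)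
have txU : t + val x \in @ounit0 M.
  by apply/asboolP; left; rewrite addrC; apply: order_unitDr.
exists n.+1, (OUnit0 txU); apply: val_inj.
by rewrite raddfMn raddfD /= addrA yt mulrSr.
Qed.

Lemma ounit0P (M : nmodType) (x : ounit0_monoid M) : x = 0 \/ order_unit (val x).
Proof.
by have /asboolP[|vx0] := valP x; [right|left; apply: val_inj].
Qed.

Lemma refinement_ounit0 (M : nmodType) :
  conical M -> refinement_monoid M -> weak_divisibility_of_order_units M ->
  refinement_monoid (ounit0_monoid M).
Proof.
move=> hcon href hwd a b c d.
(* If one of the four elements is 0, a refinement with two zero entries is immediate; otherwise all
   four are order units of [M]. *)
have [->|aU] := ounit0P a.
  by rewrite add0r => ->; exists 0, c, 0, d; rewrite !add0r.
have [->|bU] := ounit0P b.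
  by rewrite addr0 => ->; exists c, 0, d, 0; rewrite !addr0.
have [->|cU] := ounit0P c.
  by rewrite add0r => <-; exists 0, 0, a, b; rewrite !add0r.
have [->|dU] := ounit0P d.
  by rewrite addr0 => <-; exists a, b, 0, 0; rewrite !addr0.
move=> /(congr1 val); rewrite !raddfD => abcd.
have [x [y [z [w [[xU yU zU wU] [ea eb ec ed]]]]]] :=
  order_unit_refinement hcon href hwd aU bU cU dU abcd.
have inU u : order_unit u -> u \in @ounit0 M by move=> uU; apply/asboolP; left.
exists (OUnit0 (inU _ xU)), (OUnit0 (inU _ zU)),
       (OUnit0 (inU _ yU)), (OUnit0 (inU _ wU)).
by split; apply: val_inj; rewrite raddfD.
Qed.

Theorem theorem3p4 (M : nmodType)
    (hcon : conical M) (href : refinement_monoid M)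
    (hwd : weak_divisibility_of_order_units M) :
  (forall a b c d : M,
     order_unit a -> order_unit b -> order_unit c -> order_unit d ->
     a + b = c + d ->
     exists z11 z12 z21 z22 : M,
       [/\ order_unit z11, order_unit z12, order_unit z21 & order_unit z22] /\
       [/\ a = z11 + z12, b = z21 + z22, c = z11 + z21 & d = z12 + z22]) /\
  (simple_monoid (ounit0_monoid M) /\ refinement_monoid (ounit0_monoid M)).
Proof.
split; first exact: order_unit_refinement.
by split; [apply: simple_ounit0|apply: refinement_ounit0].
Qed.
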